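(* Let $\mathbf{M}$ be an $n \times n$ Hermitian matrix with eigenvalues $\lambda_1,\lambda_2,\dots,\lambda_n$ (including repetitions). Assume that the $k$ eigenvalues $\lambda_1, \ldots, \lambda_k$ are distinct. Then there exists a column vector $v\in\mathbb{C}^n$ such that, for every real $\gamma\neq 0$, the matrix $\mathbf{M} + \gamma \sqrt{-1}\, v v^*$ shares the $n-k$ eigenvalues $\lambda_{k+1},\dots ,\lambda_n$ with $\mathbf{M}$, and also the following holds: (1) if $\gamma>0$, then $\mathbf{M} + \gamma \sqrt{-1}\, v v^*$ has $k$ eigenvalues with positive imaginary part; and (2) if $\gamma <0$, then $\mathbf{M} + \gamma \sqrt{-1}\, v v^*$ has $k$ eigenvalues with negative imaginary part. Furthermore, there are many choices for the vector $v$: if $w_1,\dots,w_k$ are eigenvectors corresponding to the $k$ distinct eigenvalues $\lambda_1,\dots,\lambda_k$ of $\mathbf{M}$, then any $v=\sum_{j=1}^k z_j w_j$ suffices, so long as the complex numbers $z_j$ satisfy $z_j \ne 0$ for all $1\le j\le k$.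
   Context: Eigenvalues are counted with algebraic multiplicity; $\sqrt{-1}$ denotes the imaginary unit. *)

(* Defs.v *)
From HB Require Import structures.
From mathcomp Require Import all_boot all_order all_algebra.
From mathcomp Require Import sesquilinear spectral complex reals.
Set Implicit Arguments.
Unset Strict Implicit.
Unset Printing Implicit Defensive.
Import Order.TTheory GRing.Theory Num.Theory.
Local Open Scope ring_scope.
Local Open Scope sesquilinear_scope.

(* The family [lam] lists all n eigenvalues of [A], repeated according to
   algebraic multiplicity. *)
Definition eigenvalues_with_mult (F : fieldType) (n : nat) (A : 'M[F]_n)
    (lam : 'I_n -> F) : Prop :=
  char_poly A = \prod_(i < n) ('X - (lam i)%:P).

(* Column eigenvectors: MathComp's [eigenvalue] and [eigenspace] act on rows. *)
Definition col_eigenvector (F : fieldType) (n : nat) (A : 'M[F]_n) (a : F)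
    (w : 'cV[F]_n) : Prop :=
  w != 0 /\ A *m w = a *: w.

Definition rank_one_perturbation (R : realType) (n : nat) (M : 'M[R[i]]_n)
    (gamma : R) (v : 'cV[R[i]]_n) : 'M[R[i]]_n :=
  M + ((gamma%:C)%C * ('i)%C) *: (v *m v ^t*).

(* Indices start at 0, so lambda_(k+1), ..., lambda_n are the [lam i] with
   k <= i. The listing [mu] of the perturbed spectrum is aligned with [lam] on
   these indices, so the shared eigenvalues are counted with multiplicity. *)
Definition moves_first_eigenvalues (R : realType) (n k : nat) (M : 'M[R[i]]_n)
    (lam : 'I_n -> R[i]) (v : 'cV[R[i]]_n) : Prop :=
  forall gamma : R, gamma != 0 ->
  exists mu : 'I_n -> R[i],
    [/\ eigenvalues_with_mult (rank_one_perturbation M gamma v) mu,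
        forall i : 'I_n, (k <= i)%N -> mu i = lam i,
        0 < gamma -> #|[set i | 0 < complex.Im (mu i)]| = k
      & gamma < 0 -> #|[set i | complex.Im (mu i) < 0]| = k].

(* Main.v *)
Require Import Defs.
From HB Require Import structures.
From mathcomp Require Import all_boot all_order all_algebra.
From mathcomp Require Import sesquilinear spectral complex reals.
Set Implicit Arguments.
Unset Strict Implicit.
Unset Printing Implicit Defensive.
Import Order.TTheory GRing.Theory Num.Theory.
Local Open Scope ring_scope.
Local Open Scope sesquilinear_scope.

(* Over the spectral parameter 'X, the vector y = \sum_j P_j w_j with
   P_j = \prod_(l != j) ('X - lam_l) satisfies ('X - M) y = P v, where
   P = \prod_j ('X - lam_j) and v = \sum_j w_j.  The rank-one determinant
   identity then gives char_poly (M + g i v v^* ) = Q * S, where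
   char_poly M = Q * P and, by orthogonality of the w_j,
   S = P - g i \sum_j |w_j|^2 P_j.  As S vanishes at no lam_j, a root x of S
   satisfies 1 = g i \sum_j |w_j|^2 / (x - lam_j); the real part of this
   equation reads 1 = g (Im x) \sum_j |w_j|^2 / |x - lam_j|^2, so g Im x > 0.
   Scalars z_j are absorbed into the eigenvectors w_j. *)

(* A matrix determinant lemma with no invertibility assumption: evaluate the
   determinant of the block matrix [B, u; v, 1] in two ways. *)
Lemma det_rank_one_update (A : comNzRingType) (n : nat) (B : 'M[A]_n)
    (u y : 'cV[A]_n) (v : 'rV[A]_n) (p : A) :
  B *m y = p *: u ->
  \det (B - u *m v) * p = \det B * (p - (v *m y) 0 0).
Proof.
move=> By.
have left_factor : block_mx 1%:M (- u) 0 1%:M *m block_mx B u v 1%:M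
    = block_mx (B - u *m v) 0 v (1%:M : 'M_1).
  by rewrite mulmx_block !mul1mx !mul0mx !add0r mulNmx mulmx1 subrr.
(* The column [-y] over [p] makes the upper right block [p *: u - B *m y], which vanishes by
   hypothesis; the factor has determinant [p], hence the [p] in the identity. *)
have right_factor : block_mx B u v 1%:M *m block_mx 1%:M (- y) 0 p%:M
    = block_mx B 0 v (p%:M - v *m y).
  rewrite mulmx_block !mulmx1 !mulmx0 !addr0 !mulmxN By mul_mx_scalar addNr.
  by rewrite mul1mx addrC.
have /(congr1 determinant) := left_factor.
rewrite det_mulmx det_ublock det_lblock !det1 !mul1r mulr1 => <-.
have /(congr1 determinant) := right_factor.
rewrite det_mulmx det_ublock det_lblock !det1 mul1r det_scalar1 => ->.
by rewrite [X in _ * X]det_mx11 !mxE.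
Qed.

Lemma root_prod_XsubC_fun (A : idomainType) (I : finType) (f : I -> A) i :
  root (\prod_j ('X - (f j)%:P)) (f i).
Proof.
rewrite /root horner_prod (bigD1 i) //= hornerXsubC subrr mul0r.
exact: eqxx.
Qed.

(** * The secular polynomial and its roots *)

(** This is the secular function [1 - \sum_j a j / ('X - lam j)] with its denominators cleared, so
    that it can also be evaluated at the poles [lam j]. *)
Definition secular_poly (A : comNzRingType) (k : nat) (lam a : 'I_k -> A) :
    {poly A} :=
  \prod_j ('X - (lam j)%:P)
  - \sum_j a j *: \prod_(l | l != j) ('X - (lam l)%:P).

Lemma char_poly_eigenvector_update (F : fieldType) (n k : nat) (M : 'M[F]_n)
    (lam : 'I_k -> F) (w : 'I_k -> 'cV[F]_n) (r : 'rV[F]_n) :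
  (forall j, M *m w j = lam j *: w j) ->
  char_poly (M + (\sum_j w j) *m r) * \prod_j ('X - (lam j)%:P)
  = char_poly M * secular_poly lam (fun j => (r *m w j) 0 0).
Proof.
move=> Mw.
pose P j := \prod_(l | l != j) ('X - (lam l)%:P).
pose y := \sum_j P j *: map_mx polyC (w j).
have charE : char_poly_mx (M + (\sum_j w j) *m r)
    = char_poly_mx M - map_mx polyC (\sum_j w j) *m map_mx polyC r.
  by rewrite /char_poly_mx map_mxD map_mxM opprD addrA.
rewrite /char_poly charE.
rewrite (@det_rank_one_update _ _ _ _ y); last first.
  rewrite mulmx_sumr map_mx_sum scaler_sumr; apply: eq_bigr => j _.
  rewrite -scalemxAr mulmxBl mul_scalar_mx -map_mxM Mw map_mxZ -scalerBl.
  by rewrite scalerA (bigD1 j) //= mulrC.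
congr (_ * (_ - _)).
rewrite mulmx_sumr summxE; apply: eq_bigr => j _.
by rewrite -scalemxAr -map_mxM !mxE mulrC mul_polyC.
Qed.

(** The subtracted sum has degree below [k], so the polynomial is monic of degree [k] and has
    exactly [k] roots with multiplicity. *)
Lemma secular_poly_splits (F : closedFieldType) (k : nat) (lam a : 'I_k -> F) :
  exists mu : 'I_k -> F, secular_poly lam a = \prod_j ('X - (mu j)%:P).
Proof.
have szP : size (\prod_j ('X - (lam j)%:P)) = k.+1.
  by rewrite -big_enum size_prod_XsubC size_enum_ord.
have lt_sz :
    (size (- \sum_j a j *: \prod_(l | l != j) ('X - (lam l)%:P)) < k.+1)%N.
  rewrite size_polyN ltnS; apply: (leq_trans (size_sum _ _ _)).
  apply/bigmax_leqP => j _; apply: (leq_trans (size_scale_leq _ _)).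
  rewrite -big_filter size_prod_XsubC.
  (* One of [k] factors is omitted, so the size is [k.-1.+1]; this equals [k] because the index [j]
     forces [k] to be positive. *)
  have [e _ _ [_ ->]] := big_enumP; rewrite cardC1 card_ord.
  by rewrite prednK // (leq_ltn_trans _ (ltn_ord j)).
have sz : size (secular_poly lam a) = k.+1.
  by rewrite size_polyDl szP.
have mon : lead_coef (secular_poly lam a) = 1.
  rewrite lead_coefDl ?szP //; apply/eqP; exact: monic_prod_XsubC.
have [r] := closed_field_poly_normal (secular_poly lam a).
rewrite mon scale1r => rE.
have szr : size r = k by apply: succn_inj; rewrite -sz rE size_prod_XsubC.
by exists (fun j => r`_j); rewrite rE (big_nth 0) big_mkord szr.
Qed.

Lemma horner_secular_poly (F : fieldType) (k : nat) (lam a : 'I_k -> F) x :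
  (forall j, x != lam j) ->
  (secular_poly lam a).[x]
  = (\prod_j (x - lam j)) * (1 - \sum_j a j / (x - lam j)).
Proof.
move=> xlam; rewrite /secular_poly hornerD hornerN horner_sum horner_prod.
rewrite mulrBr mulr1 mulr_sumr; congr (_ - _).
  by apply: eq_bigr => j _; rewrite hornerXsubC.
apply: eq_bigr => j _; rewrite hornerZ horner_prod [in RHS](bigD1 j) //=.
under eq_bigr do rewrite hornerXsubC.
by rewrite [RHS]mulrC -mulrA mulKf ?subr_eq0.
Qed.

(** At [lam j] only the summand of index [j] survives, and its factors [lam j - lam l] are nonzero
    by injectivity. *)
Lemma root_secular_poly_neq (F : fieldType) (k : nat) (lam a : 'I_k -> F) x :
  injective lam -> (forall j, a j != 0) ->
  root (secular_poly lam a) x -> forall j, x != lam j.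
Proof.
move=> lamI a0 /rootP rx j; apply/eqP => xE; move: rx; apply/eqP.
rewrite /secular_poly hornerD hornerN horner_sum horner_prod xE.
rewrite (bigD1 j) //= hornerXsubC subrr mul0r add0r oppr_eq0.
rewrite (bigD1 j) //= [X in _ + X]big1 ?addr0 => [|l lj].
  rewrite hornerZ horner_prod mulf_neq0 //; apply/prodf_neq0 => l lj.
  by rewrite hornerXsubC subr_eq0 eq_sym (inj_eq lamI).
rewrite hornerZ horner_prod (bigD1 j) 1?eq_sym //= hornerXsubC subrr.
by rewrite mul0r mulr0.
Qed.

Lemma secular_root_Im (C : numClosedFieldType) (k : nat) (lam a : 'I_k -> C)
    (g x : C) :
  injective lam -> (forall j, lam j \is Num.real) -> (forall j, 0 < a j) ->
  g \is Num.real -> g != 0 ->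
  root (secular_poly lam (fun j => g * 'i * a j)) x -> 0 < g * 'Im x.
Proof.
move=> lamI lamR a0 gR g0 rx.
have xlam : forall j, x != lam j.
  apply: root_secular_poly_neq rx => // j.
  by rewrite !mulf_neq0 ?neq0Ci // gt_eqF.
pose T := \sum_j a j / `|x - lam j| ^+ 2.
have T0 : 0 <= T.
  apply: sumr_ge0 => j _; apply: divr_ge0; first exact: ltW.
  exact: exprn_ge0.
(* Each inverse is the conjugate over the squared modulus, and conjugation flips the sign of
   ['Im x], the [lam j] being real. *)
have TE : 'Im (\sum_j a j / (x - lam j)) = - ('Im x * T).
  rewrite raddf_sum /= mulr_sumr -sumrN; apply: eq_bigr => j _.
  rewrite invC_norm [in LHS]mulrA ImMl; last first.
    by apply/ger0_real/divr_ge0; [exact: ltW | exact: exprn_ge0].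
  rewrite Im_conj raddfB /= (Creal_ImP _ (lamR j)) subr0.
  by rewrite mulrN mulrC.
move/rootP: rx; rewrite horner_secular_poly // => /eqP.
rewrite mulf_eq0 => /orP[/prodf_eq0[j _]|].
  by rewrite subr_eq0 (negPf (xlam j)).
rewrite subr_eq0 => /eqP/(congr1 (fun x => 'Re x)) /=.
rewrite (eq_bigr (fun j => g * ('i * (a j / (x - lam j))))); last first.
  by move=> j _; rewrite !mulrA.
rewrite -!mulr_sumr ReMl // ReMil TE opprK mulrA.
rewrite (Creal_ReP _ (real1 C)) => gT.
(* An empty sum would give [T = 0]; strict positivity is therefore read off from
   [1 = g * 'Im x * T]. *)
have T_gt0 : 0 < T.
  rewrite lt0r T0 andbT; apply: contraTneq (oner_neq0 C) => T_eq0.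
  by rewrite gT T_eq0 mulr0 eqxx.
by rewrite -(pmulr_lgt0 _ T_gt0) -gT ltr01.
Qed.

(** * Eigenvalues and eigenvectors of Hermitian matrices *)

Lemma cV_sqnorm_gt0 (C : numClosedFieldType) (n : nat) (w : 'cV[C]_n) :
  w != 0 -> 0 < (w ^t* *m w) 0 0.
Proof.
move=> w0.
rewrite mxE; under eq_bigr do rewrite !mxE mulrC -normCK.
rewrite lt0r psumr_neq0 ?sumr_ge0 => [|i _|i _]; rewrite ?exprn_ge0 // andbT.
apply: contraNT w0 => /hasPn w_eq0; apply/eqP/colP => i; rewrite mxE.
have /= := w_eq0 i (mem_index_enum i).
by rewrite lt0r exprn_ge0 // andbT negbK expf_eq0 /= normr_eq0 => /eqP.
Qed.

(** Let [M] act on either side of [u ^t* *m M *m w]. Taking [u = w] yields real eigenvalues;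
    distinct eigenvalues yield orthogonality. *)
Lemma eigenvectors_pairing (C : numClosedFieldType) (n : nat) (M : 'M[C]_n)
    (a b : C) (u w : 'cV[C]_n) :
  M \is hermsymmx -> M *m u = a *: u -> M *m w = b *: w ->
  b *: (u ^t* *m w) = a^* *: (u ^t* *m w).
Proof.
move=> /is_hermitianmxP; rewrite expr0 scale1r => Mh Mu Mw.
rewrite scalemxAr -Mw mulmxA scalemxAl; congr (_ *m _).
have /(congr1 (fun v => v ^t*)) := Mu.
rewrite trmx_mul map_mxM -Mh => ->.
by rewrite linearZ map_mxZ.
Qed.

(** [M] and its transpose have the same characteristic polynomial, and row eigenvectors of [M^T]
    transpose to column eigenvectors of [M]. *)
Lemma root_char_poly_col_eigenvector (F : fieldType) (n : nat) (M : 'M[F]_n) a :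
  root (char_poly M) a -> exists w, col_eigenvector M a w.
Proof.
have -> : char_poly M = char_poly M^T.
  rewrite /char_poly -det_tr; congr (\det _).
  by rewrite linearB /= tr_scalar_mx map_trmx.
rewrite -eigenvalue_root_char => /eigenvalueP[v vM v0].
exists v^T; split; first by rewrite trmx_eq0.
by rewrite -[M]trmxK -trmx_mul vM linearZ.
Qed.

Lemma hermitian_eigenvalue_real (C : numClosedFieldType) (n : nat)
    (M : 'M[C]_n) a w :
  M \is hermsymmx -> col_eigenvector M a w -> a \is Num.real.
Proof.
move=> Mh [w0 Mw].
have /(congr1 (fun A : 'M_1 => A 0 0)) := eigenvectors_pairing Mh Mw Mw.
rewrite [LHS]mxE [RHS]mxE => /(mulIf (lt0r_neq0 _)) aa.
apply/CrealP; rewrite -aa //.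
exact: cV_sqnorm_gt0.
Qed.

Lemma hermitian_eigenvectors_orthogonal (C : numClosedFieldType) (n : nat)
    (M : 'M[C]_n) a b u w :
  M \is hermsymmx -> col_eigenvector M a u -> col_eigenvector M b w ->
  a != b -> u ^t* *m w = 0.
Proof.
move=> Mh Mu Mw ab; have := eigenvectors_pairing Mh Mu.2 Mw.2.
rewrite (conj_Creal (hermitian_eigenvalue_real Mh Mu)) => /eqP.
by rewrite -subr_eq0 -scalerBl scaler_eq0 subr_eq0 eq_sym (negPf ab) => /eqP.
Qed.

(** * Assembling the perturbed spectrum *)

Lemma moves_first_eigenvalues_sum (R : realType) (n k : nat) (M : 'M[R[i]]_n)
    (lam : 'I_n -> R[i]) (le_kn : (k <= n)%N) (w : 'I_k -> 'cV[R[i]]_n) :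
  M \is hermsymmx -> eigenvalues_with_mult M lam ->
  injective (fun j : 'I_k => lam (widen_ord le_kn j)) ->
  (forall j : 'I_k, col_eigenvector M (lam (widen_ord le_kn j)) (w j)) ->
  moves_first_eigenvalues k M lam (\sum_j w j).
Proof.
move=> Mh lamP lamI Mw gamma gamma0.
pose lamk j := lam (widen_ord le_kn j); pose a j := ((w j) ^t* *m w j) 0 0.
pose g : R[i] := (gamma%:C)%C.
have lamR (i : 'I_n) : lam i \is Num.real.
  have [|u Mu] := @root_char_poly_col_eigenvector _ _ M (lam i).
    by rewrite lamP root_prod_XsubC_fun.
  exact: hermitian_eigenvalue_real Mu.
have a0 j : 0 < a j by apply: cV_sqnorm_gt0; case: (Mw j).
have [muk mukP] := secular_poly_splits lamk (fun j => g * 'i * a j).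
have muk_Im j : 0 < gamma * complex.Im (muk j).
  have : 0 < g * 'Im (muk j).
    apply: (secular_root_Im (lam := lamk) (a := a)) => //.
    - by move=> l; apply: lamR.
    - by apply/complex_realP; exists gamma.
    - by rewrite (inj_eq (@complexI R) _ 0).
    - by rewrite mukP root_prod_XsubC_fun.
  by rewrite -complexIm -rmorphM ltcR.
(* [insub] succeeds exactly when [i < k]: the first [k] entries are the secular roots, the others
   are copied from [lam]. *)
pose mu i := if insub (val i) is Some j then muk j else lam i.
have mu_small j : mu (widen_ord le_kn j) = muk j.
  by rewrite /mu /= valK.
have mu_large (i : 'I_n) : (k <= i)%N -> mu i = lam i.
  by move=> ki; rewrite /mu insubN // -leqNgt.
have split_prod (f : 'I_n -> R[i]) :
    \prod_i ('X - (f i)%:P) = \prod_j ('X - (f (widen_ord le_kn j))%:P)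
      * \prod_(i < n | (k <= i)%N) ('X - (f i)%:P).
  rewrite (bigID (fun i : 'I_n => (i < k)%N)) /= (big_ord_narrow le_kn).
  by congr (_ * _); apply: eq_bigl => i; rewrite -leqNgt.
(* Stated for a general predicate to serve both signs of [gamma]; the real [lam i] satisfy neither
   strict inequality. *)
have card_mu (P : pred R[i]) :
    (forall j, P (muk j)) -> (forall i : 'I_n, ~~ P (lam i)) ->
    #|[set i | P (mu i)]| = k.
  move=> Pmu Plam; rewrite -sum1_card.
  transitivity (\sum_(i < n | (i < k)%N) 1)%N; last first.
    by rewrite (big_ord_narrow le_kn) sum1_card card_ord.
  apply: eq_bigl => i; rewrite inE; case: (ltnP i k) => [ik|ki].
    by rewrite -(Pmu (Ordinal ik)) -mu_small; congr (P (mu _)); exact: val_inj.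
  by rewrite mu_large // (negPf (Plam i)).
have lam_Im i : complex.Im (lam i) = 0.
  by have /complex_realP[x ->] := lamR i.
exists mu; split=> // [|gamma_gt0|gamma_lt0].
- rewrite /eigenvalues_with_mult split_prod.
  (* The update identity carries this product on both sides, as a factor of [char_poly M] on the
     right, so it can be cancelled. *)
  have p_neq0 : \prod_j ('X - (lamk j)%:P) != 0.
    by apply/prodf_neq0 => j _; rewrite polyXsubC_eq0.
  apply: (mulIf p_neq0).
  have -> : rank_one_perturbation M gamma (\sum_j w j)
      = M + (\sum_j w j) *m ((g * 'i) *: (\sum_j w j) ^t* ).
    by rewrite /rank_one_perturbation -scalemxAr.
  rewrite char_poly_eigenvector_update => [|j]; last by case: (Mw j).
  have mu_first : \prod_j ('X - (mu (widen_ord le_kn j))%:P)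
      = secular_poly lamk (fun j => g * 'i * a j).
    by rewrite mukP; apply: eq_bigr => j _; rewrite mu_small.
  rewrite lamP split_prod mu_first mulrC mulrCA [RHS]mulrC; congr (_ * (_ * _)).
    congr (_ - _); apply: eq_bigr => j _; congr (_ *: _).
    rewrite -scalemxAl mxE; congr (_ * _).
    (* Orthogonality removes the cross terms, leaving the squared norm [a j]. *)
    rewrite raddf_sum map_mx_sum mulmx_suml summxE (bigD1 j) //=.
    rewrite big1 ?addr0 // => l lj.
    rewrite (hermitian_eigenvectors_orthogonal Mh (Mw l) (Mw j)) ?mxE //.
    by rewrite (inj_eq lamI).
  by apply: eq_bigr => i ki; rewrite mu_large.
- apply: (card_mu (fun x : R[i] => 0 < complex.Im x)) => [j|i].
    by rewrite -(pmulr_rgt0 _ gamma_gt0).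
  by rewrite lam_Im ltxx.
- apply: (card_mu (fun x : R[i] => complex.Im x < 0)) => [j|i].
    by rewrite -(nmulr_rgt0 _ gamma_lt0).
  by rewrite lam_Im ltxx.
Qed.

Theorem theorem2p4 (R : realType) (n k : nat) (M : 'M[R[i]]_n)
    (lam : 'I_n -> R[i]) (le_kn : (k <= n)%N)
    (M_herm : M \is hermsymmx)
    (lamP : eigenvalues_with_mult M lam)
    (lam_distinct : injective (fun j : 'I_k => lam (widen_ord le_kn j))) :
  (exists v : 'cV[R[i]]_n, moves_first_eigenvalues k M lam v) /\
  (forall (w : 'I_k -> 'cV[R[i]]_n) (z : 'I_k -> R[i]),
     (forall j : 'I_k, col_eigenvector M (lam (widen_ord le_kn j)) (w j)) ->
     (forall j : 'I_k, z j != 0) ->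
     moves_first_eigenvalues k M lam (\sum_(j < k) z j *: w j)).
Proof.
split=> [|w z Mw z0].
  have /fin_all_exists[w Mw] : forall j : 'I_k,
      exists w, col_eigenvector M (lam (widen_ord le_kn j)) w.
    move=> j; apply: root_char_poly_col_eigenvector.
    by rewrite lamP root_prod_XsubC_fun.
  (* The witness has all coefficients equal to 1. *)
  by exists (\sum_j w j); exact: moves_first_eigenvalues_sum Mw.
apply: moves_first_eigenvalues_sum => // j; have [w0 Mwj] := Mw j.
split; first by rewrite scaler_eq0 negb_or z0.
by rewrite -scalemxAr Mwj !scalerA mulrC.
Qed.
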